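(* Let $A$ be an $m\times n$ complex matrix and let $l,k$ be positive integers with $l<m$ and $k<n$. Then $$w(A)=\Big\{z\in\mathbb{C}: |z|\le \max_{\substack{\xi_1,\ldots,\xi_l\in\mathbb{C}^m\\ \eta_1,\ldots,\eta_k\in\mathbb{C}^n}}\big\|[\,\xi_i^*A\eta_j\,]_{i,j=1}^{l,k}\big\|_2\Big\},$$ where the maximum is taken over all orthonormal families $\{\xi_1,\ldots,\xi_l\}$ in $\mathbb{C}^m$ and all orthonormal families $\{\eta_1,\ldots,\eta_k\}$ in $\mathbb{C}^n$.
   Context: For an $m\times n$ complex matrix $A$, $w(A)=\{y^*Ax : x\in\mathbb{C}^n,\ y\in\mathbb{C}^m,\ \|x\|_2=\|y\|_2=1\}$. $\|\cdot\|_2$ of a matrix is the spectral norm, and $[\xi_i^*A\eta_j]_{i,j=1}^{l,k}$ is the $l\times k$ matrix with $(i,j)$ entry $\xi_i^*A\eta_j$. *)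

(* Defs.v *)
(* The field of complex numbers is R[i] for an arbitrary R : realType. *)
From HB Require Import structures.
From mathcomp Require Export all_boot all_order all_algebra.
From mathcomp Require Export spectral complex.
From mathcomp Require Export boolp classical_sets reals.

Set Implicit Arguments.
Unset Strict Implicit.
Unset Printing Implicit Defensive.

Export Order.TTheory GRing.Theory Num.Theory.
Local Open Scope ring_scope.
Local Open Scope sesquilinear_scope.
Local Open Scope classical_set_scope.

(* The real-valued modulus: `|z| = (cmod z)%:C in R[i]. *)
Notation cmod := ComplexField.Normc.normc.

Definition norm2 (R : realType) (n : nat) (x : 'cV[R[i]]_n) : R :=
  Num.sqrt (\sum_(i < n) cmod (x i 0) ^+ 2).

(* y^* B x, as a scalar; y ^t* is the conjugate transpose of y. *)
Definition sesqform (R : realType) (m n : nat) (B : 'M[R[i]]_(m, n))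
  (y : 'cV[R[i]]_m) (x : 'cV[R[i]]_n) : R[i] := (y ^t* *m B *m x) 0 0.

(* The sup is a true least upper bound only when 0 < n: otherwise C^n has no
   unit vector and the value is the default sup set0 = 0. *)
Definition spectral_norm (R : realType) (m n : nat) (B : 'M[R[i]]_(m, n)) : R :=
  sup [set norm2 (B *m x) | x in [set x | norm2 x = 1]].

Definition numerical_range (R : realType) (m n : nat) (A : 'M[R[i]]_(m, n)) :
    set R[i] :=
  [set z | exists (x : 'cV[R[i]]_n) (y : 'cV[R[i]]_m),
    [/\ norm2 x = 1, norm2 y = 1 & z = sesqform A y x]].

Definition orthonormal_family (R : realType) (n l : nat)
    (xi : 'I_l -> 'cV[R[i]]_n) : Prop :=
  forall i j : 'I_l, ((xi i) ^t* *m xi j) 0 0 = (i == j)%:R.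

Definition compression (R : realType) (m n : nat) (A : 'M[R[i]]_(m, n))
    (l k : nat) (xi : 'I_l -> 'cV[R[i]]_m) (eta : 'I_k -> 'cV[R[i]]_n) :
    'M[R[i]]_(l, k) :=
  \matrix_(i < l, j < k) sesqform A (xi i) (eta j).

Definition compression_norms (R : realType) (m n : nat) (A : 'M[R[i]]_(m, n))
    (l k : nat) : set R :=
  [set r | exists (xi : 'I_l -> 'cV[R[i]]_m) (eta : 'I_k -> 'cV[R[i]]_n),
    [/\ orthonormal_family xi, orthonormal_family eta &
        r = spectral_norm (compression A xi eta)]].

Definition is_maximum (R : realType) (S : set R) (r : R) : Prop :=
  S r /\ ubound S r.

(* Main.v *)
(* Let s be the spectral norm of A. It is attained at a unit vector x: take an
   eigenvector of A^* A for its largest eigenvalue. Write A x = s u, |u| = 1.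
   By Cauchy-Schwarz |y^* A x'| <= s for all unit x', y. Conversely, since m > 1
   there is a unit v orthogonal to u, and for |c| <= 1 the unit vector
   y = conj(c) u + sqrt(1 - |c|^2) v gives y^* A x = c s; so w(A) is the disk of
   radius s. A compression is X^* A E with isometries X and E, so its norm is at
   most s; equality holds when the families extend u and x, because its (1,1)
   entry is then s. *)
Require Import Defs.

Set Implicit Arguments.
Unset Strict Implicit.
Unset Printing Implicit Defensive.

Local Open Scope ring_scope.
Local Open Scope classical_set_scope.
Local Open Scope sesquilinear_scope.

(** * Modulus, Euclidean norm and isometries *)

Lemma complex_cmod (R : realType) (z : R[i]) : (cmod z)%:C%C = `|z|.
Proof. by []. Qed.

Lemma cmod_ge0 (R : realType) (z : R[i]) : 0 <= cmod z.
Proof. by rewrite -ler0c complex_cmod. Qed.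

Lemma cmod_real (R : realType) (r : R) : 0 <= r -> cmod r%:C%C = r.
Proof. by move=> ?; rewrite /= expr0n addr0 sqrtr_sqr ger0_norm. Qed.

Lemma norm2_ge0 (R : realType) n (x : 'cV[R[i]]_n) : 0 <= norm2 x.
Proof. exact: sqrtr_ge0. Qed.

Lemma norm2_sqr (R : realType) n (x : 'cV[R[i]]_n) :
  (norm2 x ^+ 2)%:C%C = (x ^t* *m x) 0 0.
Proof.
rewrite sqr_sqrtr ?sumr_ge0 // => [|i _]; last exact: sqr_ge0.
rewrite rmorph_sum mxE; apply: eq_bigr => i _ /=.
by rewrite !mxE rmorphXn/= complex_cmod normCK mulrC.
Qed.

Lemma norm2_eqP (R : realType) n (x : 'cV[R[i]]_n) (r : R) : 0 <= r ->
  (x ^t* *m x) 0 0 = (r ^+ 2)%:C%C -> norm2 x = r.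
Proof.
move=> r_ge0; rewrite -norm2_sqr => /(@complexI R) /eqP.
by rewrite eqrXn2 ?norm2_ge0 // => /eqP.
Qed.

Lemma norm2Z (R : realType) n (c : R[i]) (x : 'cV[R[i]]_n) :
  norm2 (c *: x) = cmod c * norm2 x.
Proof.
apply: norm2_eqP; first by rewrite mulr_ge0 ?cmod_ge0 ?norm2_ge0.
rewrite exprMn rmorphM/= norm2_sqr rmorphXn/= complex_cmod normCK.
have -> : (c *: x)^t* = c^* *: x^t*.
  by apply/matrixP => i j; rewrite !mxE rmorphM.
by rewrite -scalemxAl -scalemxAr scalerA mxE [_^* * _]mulrC.
Qed.

Lemma norm2_eq0 (R : realType) n (x : 'cV[R[i]]_n) : norm2 x = 0 -> x = 0.
Proof.
move=> x0; apply/eqP/negPn/negP => x_neq0.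
have /eqP := norm2_sqr x; rewrite x0 expr0n/= => /eqP/esym/eqP.
suff : 0 < (x^t* *m x) 0 0 by rewrite lt0r => /andP[/negP].
(* [dotmx] is a form on rows, so its positivity is applied to x^*. *)
have := @dotmx_is_dotmx _ _ (x^t* : 'rV_n); rewrite dotmxE trmxCK; apply.
by apply: contraNneq x_neq0 => xs0; rewrite -[x]trmxCK xs0 trmx0 map_mx0.
Qed.

Lemma norm2_delta (R : realType) n (i : 'I_n) :
  norm2 (delta_mx i 0 : 'cV[R[i]]_n) = 1.
Proof.
apply: norm2_eqP => //.
by rewrite trmx_delta map_delta_mx mul_delta_mx mxE !eqxx expr1n.
Qed.

Lemma cauchy_schwarz (R : realType) n (y x : 'cV[R[i]]_n) :
  cmod ((y ^t* *m x) 0 0) <= norm2 y * norm2 x.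
Proof.
rewrite -(@ler_pXn2r _ 2) ?nnegrE ?mulr_ge0 ?cmod_ge0 ?norm2_ge0 //.
rewrite -lecR exprMn [X in _ <= X]rmorphM/= !norm2_sqr rmorphXn/= complex_cmod.
have [+ _] := CauchySchwarz (@dotmx _ n) (y^t*) (x^t*).
by rewrite /= !dotmxE !trmxCK.
Qed.

Lemma norm2_isometry (R : realType) m n (X : 'M[R[i]]_(m, n)) (w : 'cV_n) :
  X ^t* *m X = 1%:M -> norm2 (X *m w) = norm2 w.
Proof.
move=> XX; apply: norm2_eqP; rewrite ?norm2_ge0 // norm2_sqr.
by rewrite trmx_mul map_mxM mulmxA -(mulmxA _ _ X) XX mulmx1.
Qed.

(** If v = 0, any unit vector serves as u, and [0 < n] supplies one; otherwise normalize v. *)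
Lemma norm2_direction (R : realType) n (v : 'cV[R[i]]_n) : (0 < n)%N ->
  exists2 u, norm2 u = 1 & v = (norm2 v)%:C%C *: u.
Proof.
move=> n_gt0; have [v0|v_neq0] := eqVneq (norm2 v) 0.
  exists (delta_mx (Ordinal n_gt0) 0); first exact: norm2_delta.
  by rewrite v0 scale0r; exact: norm2_eq0.
have cv_neq0 : (norm2 v)%:C%C != 0 :> R[i] by rewrite fmorph_eq0.
exists ((norm2 v)%:C%C^-1 *: v); last by rewrite scalerA divff ?scale1r.
by rewrite norm2Z ComplexField.Normc.normcV cmod_real ?norm2_ge0 // mulVf.
Qed.

(** * Attainment of the spectral norm *)

(** Diagonalizing A^* A = P^* D P with P unitary gives |A u|^2 = sum_i d_i |(P u)_i|^2, which is at
    most max_i d_i times |u|^2. The supremum is kept out of the statement because this bound is what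
    shows that it is finite. *)
Lemma norm2_maximizer (R : realType) m n (A : 'M[R[i]]_(m, n)) : (0 < n)%N ->
  exists2 x, norm2 x = 1 &
    forall u, norm2 (A *m u) <= norm2 (A *m x) * norm2 u.
Proof.
move=> n_gt0; pose M := A^t* *m A.
have Mherm : M \is hermsymmx.
  by apply/is_hermitianmxP; rewrite scale1r /M trmx_mul map_mxM trmxCK.
have /orthomx_spectralP := hermitian_normalmx Mherm.
have dR := mxOverP (hermitian_spectral_diag_real Mherm).
set P := spectralmx M; set d := spectral_diag M in dR * => ME.
have Pu : P \is unitarymx := spectral_unitarymx M.
have PP : P^t* *m P = 1%:M by rewrite -invmx_unitary // mulVmx ?unitarymx_unit.
have AE u : (norm2 (A *m u) ^+ 2)%:C%C = \sum_i d 0 i * `|(P *m u) i 0| ^+ 2.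
  rewrite norm2_sqr trmx_mul map_mxM mulmxA -(mulmxA _ _ A) -/M ME.
  rewrite invmx_unitary // -!mulmxA mulmxA -map_mxM -trmx_mul mxE.
  apply: eq_bigr => i _; rewrite mul_diag_mx !mxE normCK.
  by rewrite mulrCA [_^* * _]mulrC.
(* The order on [R[i]] is partial, so the maximum is taken over real parts; [dR] says that the
   eigenvalues are real. *)
have [i0 _ dmax] :=
  @arg_maxP _ _ _ (Ordinal n_gt0) xpredT (fun i => complex.Re (d 0 i)) isT.
pose x : 'cV_n := P^t* *m delta_mx i0 0.
have Px : P *m x = delta_mx i0 0.
  by rewrite /x mulmxA (unitarymxP Pu) mul1mx.
have Ax : (norm2 (A *m x) ^+ 2)%:C%C = d 0 i0.
  rewrite AE Px (bigD1 i0) //= big1 ?mxE ?eqxx ?normr1 ?expr1n ?mulr1 ?addr0 //.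
  by move=> i /negPf ni; rewrite mxE ni normr0 expr0n mulr0.
exists x; first by rewrite -(norm2_isometry x PP) Px norm2_delta.
move=> u; rewrite -(@ler_pXn2r _ 2) ?nnegrE ?mulr_ge0 ?norm2_ge0 //.
rewrite -lecR exprMn [X in _ <= X]rmorphM/= Ax AE.
rewrite -(norm2_isometry u PP) norm2_sqr.
(* Compare the two sums term by term, using d_i <= d_i0. *)
rewrite [X in _ <= _ * X]mxE mulr_sumr ler_sum // => i _.
rewrite !mxE [_^* * _]mulrC -normCK ler_wpM2r ?exprn_ge0 //.
by rewrite -[d 0 i]RRe_real // -[d 0 i0]RRe_real // lecR; exact: dmax.
Qed.

Lemma spectral_norm_max (R : realType) m n (A : 'M[R[i]]_(m, n)) : (0 < n)%N ->
  exists x, [/\ norm2 x = 1, norm2 (A *m x) = spectral_norm A &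
    forall u, norm2 (A *m u) <= spectral_norm A * norm2 u].
Proof.
move=> n_gt0; have [x x1 xmax] := norm2_maximizer A n_gt0.
suff s : norm2 (A *m x) = spectral_norm A by exists x; rewrite -s.
apply/eqP; rewrite eq_le; apply/andP; split.
  apply: ub_le_sup; last by exists x.
  exists (norm2 (A *m x)) => _ [u /= u1 <-].
  by rewrite (le_trans (xmax u)) // u1 mulr1.
apply: ge_sup; first by exists (norm2 (A *m x)), x.
by move=> _ [u /= u1 <-]; rewrite (le_trans (xmax u)) // u1 mulr1.
Qed.

(** * Orthonormal families and compressions *)

Definition family_mx (R : realType) n l (xi : 'I_l -> 'cV[R[i]]_n) :
  'M[R[i]]_(n, l) := \matrix_(i, j) xi j i 0.

Lemma family_mx_delta (R : realType) n l (xi : 'I_l -> 'cV[R[i]]_n) j :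
  family_mx xi *m delta_mx j 0 = xi j.
Proof. by rewrite -colE; apply/colP => i; rewrite !mxE. Qed.

Lemma family_mx_isometry (R : realType) n l (xi : 'I_l -> 'cV[R[i]]_n) :
  orthonormal_family xi -> (family_mx xi) ^t* *m family_mx xi = 1%:M.
Proof.
move=> xi_on; apply/matrixP => i j; rewrite [RHS]mxE -xi_on !mxE.
by apply: eq_bigr => k _; rewrite !mxE.
Qed.

(** With X and E the matrices whose columns are the families, the compression is X^* A E. *)
Lemma sesqform_compression (R : realType) m n (A : 'M[R[i]]_(m, n)) l k
  (xi : 'I_l -> 'cV[R[i]]_m) (eta : 'I_k -> 'cV[R[i]]_n) w v :
  sesqform (compression A xi eta) w v =
  sesqform A (family_mx xi *m w) (family_mx eta *m v).
Proof.
have -> : compression A xi eta = (family_mx xi) ^t* *m A *m family_mx eta.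
  apply/matrixP => i j; rewrite mxE /sesqform !mxE.
  apply: eq_bigr => b _; rewrite !mxE; congr (_ * _).
  by apply: eq_bigr => a _; rewrite !mxE.
by rewrite /sesqform trmx_mul map_mxM !mulmxA.
Qed.

Lemma orthonormal_extension (R : realType) n l (u : 'cV[R[i]]_n) :
  (l < n)%N -> norm2 u = 1 ->
  exists2 xi : 'I_l.+1 -> 'cV[R[i]]_n, orthonormal_family xi & xi ord0 = u.
Proof.
move=> l_lt_n u1.
(* Gram-Schmidt gives u^* = c S_0 with c >= 0, and |u| = 1 forces c = 1; all
   rows of U but the first are arbitrary. *)
pose U : 'M[R[i]]_(l.+1, n) := \matrix_(i < l.+1) u^t*.
pose S := schmidt U.
have Son : forall i j, _ := row_unitarymxP (schmidt_unitarymx U l_lt_n).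
have U0 : row ord0 U = u^t* by rewrite rowK.
(* Row i of U lies in the span of the rows of S of index at most i; for i = 0 only one row
   remains. *)
have : (row ord0 U <= row ord0 S)%MS.
  apply: submx_trans (row_schmidt_sub U ord0) _.
  apply/sumsmx_subP => k; rewrite leqn0 => /eqP k0.
  by rewrite genmxE (_ : k = ord0) //; exact: val_inj.
case/sub_rVP => c uE.
have c_ge0 : 0 <= c.
  have := form1_row_schmidt U ord0.
  by rewrite uE linearZl_LR/= Son eqxx mulr1.
have c1 : c = 1.
  have : (u^t* *m u) 0 0 = 1 by rewrite -norm2_sqr u1 expr1n.
  rewrite -U0 uE -[u in _ *m u]trmxCK -U0 uE -dotmxE.
  rewrite linearZl_LR linearZr_LR/= Son eqxx mulr1 -normCK ger0_norm //.
  by move/eqP; rewrite sqrp_eq1 // => /eqP.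
exists (fun i => (row i S)^t*).
  by move=> i j; rewrite trmxCK -dotmxE Son.
by rewrite -[row _ _]scale1r -c1 -uE U0 trmxCK.
Qed.

Lemma sesqform_le (R : realType) m n (A : 'M[R[i]]_(m, n)) y x : (0 < n)%N ->
  cmod (sesqform A y x) <= spectral_norm A * (norm2 y * norm2 x).
Proof.
move=> n_gt0; have [_ [_ _ Amax]] := spectral_norm_max A n_gt0.
rewrite /sesqform -mulmxA (le_trans (cauchy_schwarz _ _)) // mulrCA.
by rewrite ler_wpM2l ?norm2_ge0.
Qed.

(** Let B be the compression, v a unit maximizer and w = B v. Then |w|^2 = w^* B v = (X w)^* A (E v)
    <= s |w|, with s the norm of A, since X and E are isometries; divide by |w|. *)
Lemma spectral_norm_compression_le (R : realType) m n (A : 'M[R[i]]_(m, n)) l k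
  (xi : 'I_l -> 'cV[R[i]]_m) (eta : 'I_k -> 'cV[R[i]]_n) :
  (0 < k)%N -> (0 < n)%N -> orthonormal_family xi -> orthonormal_family eta ->
  spectral_norm (compression A xi eta) <= spectral_norm A.
Proof.
move=> k_gt0 n_gt0 /family_mx_isometry xi_iso /family_mx_isometry eta_iso.
have [v [v1 <- _]] := spectral_norm_max (compression A xi eta) k_gt0.
have [x [_ Ax _]] := spectral_norm_max A n_gt0.
set w := compression A xi eta *m v.
have [->|w_neq0] := eqVneq (norm2 w) 0; first by rewrite -Ax norm2_ge0.
have w_gt0 : 0 < norm2 w by rewrite lt0r w_neq0 norm2_ge0.
rewrite -(ler_pM2r w_gt0) -expr2.
have -> : norm2 w ^+ 2 = cmod (sesqform (compression A xi eta) w v).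
  by rewrite /sesqform -mulmxA -norm2_sqr cmod_real ?sqr_ge0.
rewrite sesqform_compression.
rewrite (le_trans (sesqform_le _ _ _ n_gt0)) //.
by rewrite (norm2_isometry _ xi_iso) (norm2_isometry _ eta_iso) v1 mulr1.
Qed.

Lemma numerical_rangeE (R : realType) m n (A : 'M[R[i]]_(m, n)) :
  (1 < m)%N -> (0 < n)%N ->
  numerical_range A = [set z : R[i] | cmod z <= spectral_norm A].
Proof.
move=> m_gt1 n_gt0; apply/seteqP; split => [_ [x [y [x1 y1 ->]]]|z] /=.
  by rewrite (le_trans (sesqform_le _ _ _ n_gt0)) // x1 y1 !mulr1.
have [x [x1 Ax _]] := spectral_norm_max A n_gt0; rewrite -Ax => z_le.
have [u u1 AxE] := norm2_direction (A *m x) (ltnW m_gt1).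
(* Here the family has two members: u and a unit vector orthogonal to it. *)
have [xi /family_mx_isometry xi_iso xi0] := orthonormal_extension m_gt1 u1.
have [c c_le1 ->] : exists2 c, cmod c <= 1 & z = c * (norm2 (A *m x))%:C%C.
  (* When A x = 0 the disk is the single point 0, and c = 0 serves. *)
  have [s0|s_neq0] := eqVneq (norm2 (A *m x)) 0.
    exists 0; first by rewrite ComplexField.Normc.normc0.
    rewrite mul0r; apply: ComplexField.Normc.eq0_normc.
    by apply/eqP; rewrite eq_le cmod_ge0 -s0 z_le.
  have s_gt0 : 0 < norm2 (A *m x) by rewrite lt0r s_neq0 norm2_ge0.
  exists (z / (norm2 (A *m x))%:C%C); last by rewrite divfK ?fmorph_eq0.
  rewrite ComplexField.Normc.normcM ComplexField.Normc.normcV.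
  by rewrite cmod_real ?norm2_ge0 // ler_pdivrMr // mul1r.
(* [w] holds the coordinates of y in the pair [xi]. The first is the conjugate of c because y enters
   the form conjugated; [s] completes [w] to a unit vector. *)
pose s := Num.sqrt (1 - cmod c ^+ 2).
pose w : 'cV[R[i]]_2 := \col_i (if i == ord0 then c^* else s%:C%C).
exists x, (family_mx xi *m w); split => //.
  rewrite norm2_isometry //; apply: norm2_eqP => //.
  rewrite mxE !big_ord_recl big_ord0 addr0 !mxE /= conjCK -normCK -complex_cmod.
  rewrite [_^*]conj_Creal; last by apply/complex_realP; exists s.
  rewrite -expr2 -!rmorphXn -rmorphD/= sqr_sqrtr; last first.
    by rewrite subr_ge0 expr_le1 ?cmod_ge0.
  by rewrite addrC subrK expr1n.
rewrite /sesqform -mulmxA [in RHS]AxE -xi0 -(family_mx_delta xi) -scalemxAr.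
rewrite trmx_mul map_mxM mulmxA -(mulmxA _ _ (family_mx xi)) xi_iso mulmx1 mxE.
by rewrite -colE !mxE eqxx /= conjCK mulrC.
Qed.

Theorem proposition4 (R : realType) (m n : nat) (A : 'M[R[i]]_(m, n))
  (l k : nat) (hl : (0 < l)%N) (hk : (0 < k)%N) (hlm : (l < m)%N)
  (hkn : (k < n)%N) :
  exists r : R,
    is_maximum (compression_norms A l k) r /\
    numerical_range A = [set z : R[i] | cmod z <= r].
Proof.
have m_gt0 := leq_ltn_trans (leq0n l) hlm.
have n_gt0 := leq_ltn_trans (leq0n k) hkn.
exists (spectral_norm A); split; last first.
  exact: numerical_rangeE (leq_ltn_trans hl hlm) n_gt0.
split; last first.
  by move=> _ [xi [eta [xi_on eta_on ->]]]; exact: spectral_norm_compression_le.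
have [x [x1 Ax _]] := spectral_norm_max A n_gt0.
have [u u1 AxE] := norm2_direction (A *m x) m_gt0.
(* Successor sizes give both families a first index [ord0], where u and x are placed. *)
case: l hl hlm => // l _ hlm; case: k hk hkn => // k hk hkn.
have [xi xi_on xi0] := orthonormal_extension (ltnW hlm) u1.
have [eta eta_on eta0] := orthonormal_extension (ltnW hkn) x1.
exists xi, eta; split=> //; apply/eqP; rewrite eq_le.
rewrite spectral_norm_compression_le // andbT.
(* Testing on the first basis vectors bounds the modulus of the first entry by the norm of the
   compression; that entry is u^* A x = |A x|. *)
have := sesqform_le (compression A xi eta)
  (delta_mx ord0 0) (delta_mx ord0 0) hk.
rewrite !norm2_delta !mulr1; apply: le_trans.
suff -> : sesqform (compression A xi eta) (delta_mx ord0 0) (delta_mx ord0 0)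
    = (spectral_norm A)%:C%C.
  by rewrite cmod_real // -Ax norm2_ge0.
rewrite sesqform_compression !family_mx_delta xi0 eta0 /sesqform -mulmxA AxE.
by rewrite -scalemxAr mxE -norm2_sqr u1 expr1n mulr1 Ax.
Qed.
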